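(* Let $R$ be a commutative noetherian ring, let $I,\mathfrak{a}\subset R$ be ideals of positive height, and let $t\in\mathbb{R}_{>0}$. (a) The sets ${}^{\mathfrak{a}^t}\overline{I}$ and $\overline{I}^{\mathfrak{a}^t}$ are ideals of $R$. (b) $\overline{I}={}^{\mathfrak{a}^t}\overline{I}\subset \overline{I}^{\mathfrak{a}^t}$, where $\overline{I}$ is the usual integral closure of $I$. (c) If $J,\mathfrak{b}\subset R$ are ideals and $s\in\mathbb{R}_{>0}$ with $I\subset J$, $\mathfrak{b}\subset\mathfrak{a}$, and $t\le s$, then $\overline{I}^{\mathfrak{a}^t}\subset\overline{J}^{\mathfrak{b}^s}$.
   Context: All rings are commutative with unit and noetherian. $R^\circ$ is the set of elements of $R$ not in any minimal prime of $R$. An ideal has positive height if it is not contained in any minimal prime. For ideals $I,\mathfrak{a}\subset R$ and $t\in\mathbb{R}_{>0}$ define the Hara-Yoshida $\mathfrak{a}^t$-integral closure $$\overline{I}^{\mathfrak{a}^t}=\{x\in R\mid \text{for some } c\in R^\circ \text{ and all } n\gg 0,\ cx^n\mathfrak{a}^{\lceil tn\rceil}\subset I^n\}$$ and the Vraciu $\mathfrak{a}^t$-integral closure $${}^{\mathfrak{a}^t}\overline{I}=\{x\in R\mid \text{for some } c\in R^\circ \text{ and all } n\gg 0,\ cx^n\mathfrak{a}^{\lceil tn\rceil}\subset \mathfrak{a}^{\lceil tn\rceil}I^n\}.$$ The symbol $\subset$ allows equality. *)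

(* Defs.v *)
From HB Require Import structures.
From mathcomp Require Import all_boot all_order all_algebra.
From mathcomp Require Import boolp classical_sets filter reals.

Set Implicit Arguments.
Unset Strict Implicit.
Unset Printing Implicit Defensive.

Import Order.TTheory GRing.Theory Num.Theory.

Local Open Scope classical_set_scope.
Local Open Scope ring_scope.

(* MathComp's [idealr] only covers proper, decidable ideals of nonzero rings;
   here an ideal may be the unit ideal, and the zero ring is allowed. *)
Definition is_ideal (R : comPzRingType) (I : set R) : Prop :=
  [/\ I 0,
      forall x y, I x -> I y -> I (x + y)
    & forall a x, I x -> I (a * x)].

Definition ideal_gen (R : comPzRingType) (S : set R) : set R :=
  smallest (@is_ideal R) S.

Definition ideal_mul (R : comPzRingType) (I J : set R) : set R :=
  ideal_gen [set x * y | x in I & y in J].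

Fixpoint ideal_exp (R : comPzRingType) (I : set R) (n : nat) : set R :=
  if n is m.+1 then ideal_mul I (ideal_exp I m) else setT.

Definition noetherian (R : comPzRingType) : Prop :=
  forall I : set R, is_ideal I -> exists s : seq R, I = ideal_gen [set` s].

Definition prime_ideal (R : comPzRingType) (P : set R) : Prop :=
  [/\ is_ideal P, ~ P 1 & forall x y, P (x * y) -> P x \/ P y].

Definition minimal_prime (R : comPzRingType) (P : set R) : Prop :=
  prime_ideal P /\ forall Q : set R, prime_ideal Q -> Q `<=` P -> Q = P.

(* The set written R° in the literature. *)
Definition avoids_minimal_primes (R : comPzRingType) : set R :=
  [set c | forall P : set R, minimal_prime P -> ~ P c].

Definition positive_height (R : comPzRingType) (I : set R) : Prop :=
  forall P : set R, minimal_prime P -> ~ (I `<=` P).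

Definition integral_closure (R : comPzRingType) (I : set R) : set R :=
  [set x | exists2 n : nat, (0 < n)%N &
     exists2 a : nat -> R,
       forall i : nat, (1 <= i <= n)%N -> ideal_exp I i (a i) &
       x ^+ n + \sum_(1 <= i < n.+1) a i * x ^+ (n - i) = 0].

(* [Num.ceil] is int-valued; the absolute value is harmless since t > 0. *)
Definition ceil_mul (K : realType) (t : K) (n : nat) : nat :=
  `|Num.ceil (t * n%:R)|%N.

Definition hara_yoshida_closure (R : comPzRingType) (K : realType)
    (A : set R) (t : K) (I : set R) : set R :=
  [set x | exists2 c : R, avoids_minimal_primes c &
     \forall n \near \oo,
       [set c * x ^+ n * y | y in ideal_exp A (ceil_mul t n)]
         `<=` ideal_exp I n].

Definition vraciu_closure (R : comPzRingType) (K : realType)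
    (A : set R) (t : K) (I : set R) : set R :=
  [set x | exists2 c : R, avoids_minimal_primes c &
     \forall n \near \oo,
       [set c * x ^+ n * y | y in ideal_exp A (ceil_mul t n)]
         `<=` ideal_mul (ideal_exp A (ceil_mul t n)) (ideal_exp I n)].

(* Main.v *)
Require Import Defs.
From HB Require Import structures.
From mathcomp Require Import all_boot all_order all_algebra.
From mathcomp Require Import boolp classical_sets filter reals ring lra zify.

Set Implicit Arguments.
Unset Strict Implicit.
Unset Printing Implicit Defensive.

Import Order.TTheory GRing.Theory Num.Theory.

Local Open Scope classical_set_scope.
Local Open Scope ring_scope.

(** The substance is the inclusion of the Vraciu closure in the integral
    closure; the rest follows from it together with elements of [R°].

    Write [a n] for the ceiling of [t n], and let [x] satisfy
    [c x^n A^(a n) <= A^(a n) I^n] for large [n].  Instead of a determinant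
    trick followed by the valuative criterion, the proof uses noetherianity of
    the bigraded Rees algebra of [I] and [A] ([rees_noetherian]): in the
    bigraded module generated by the [c x^n A^(a n)], placed in bidegree
    [(n, a n)], the generators with [n <= N] suffice for some [N].  With
    [J = I + (x)], reading off the component of bidegree [(N+1, a (N+1))] gives
    [c x^(N+1) A^q <= c A^q I J^N], where [q = a (N+1)] ([stable_reduction]).

    If [A = R], this says [c (x^(N+1) - w) = 0] with [w] in [I J^N].  An
    element killed by some [c] in [R°] lies in every minimal prime, hence is
    nilpotent, and a power of [x^(N+1) - w] is an equation of integral
    dependence of [x] on [I] ([integral_of_exp]).  In general, the module
    [M = c A^q J^N] satisfies [x M <= I M], hence [x^n M <= I^n M <= I^n] for
    all [n]; as [M] meets [R°], the case [A = R] applies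
    ([integral_of_mul_exp]).

    Conversely, if [x] satisfies an integral equation of degree [k] then
    [x^n] is in [I^(n-k)], so the [k]-th power of any [f] in [I] and in [R°]
    is a suitable multiplier.  Such [f] exist by prime avoidance, since a
    noetherian ring has finitely many minimal primes.

    The Hara-Yoshida closure is an ideal by the binomial theorem: the rounding
    defect [a i + a j <= a (i + j) + 1] is absorbed by one element of [A] in
    [R°].  The Vraciu closure does not depend on [A], and for [A = R] the two
    closures coincide, so it is an ideal as well. *)
(** * Ideals, products and powers *)

Section Ideals.
Variable R : comPzRingType.
Implicit Types (I J K : set R) (x y z : R).

Lemma ideal0 I : is_ideal I -> I 0. Proof. by case. Qed.

Lemma idealD I x y : is_ideal I -> I x -> I y -> I (x + y).
Proof. by case=> _ + _; apply. Qed.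

Lemma idealMl I a x : is_ideal I -> I x -> I (a * x).
Proof. by case=> _ _; apply. Qed.

Lemma idealMr I a x : is_ideal I -> I x -> I (x * a).
Proof. by rewrite mulrC; apply: idealMl. Qed.

Lemma idealN I x : is_ideal I -> I x -> I (- x).
Proof. by move=> idI Ix; rewrite -mulN1r; apply: idealMl. Qed.

Lemma ideal_sum I (T : Type) (r : seq T) (P : pred T) (F : T -> R) :
  is_ideal I -> (forall i, P i -> I (F i)) -> I (\sum_(i <- r | P i) F i).
Proof.
move=> idI IF; apply: (big_ind I) => //; first exact: ideal0.
by move=> x y; apply: idealD.
Qed.

Lemma setT_ideal : is_ideal (setT : set R).
Proof. by split. Qed.

Lemma ideal_gen_ideal (S : set R) : is_ideal (ideal_gen S).
Proof.
split=> [I [idI _]|x y Sx Sy I SI|a x Sx I SI]; first exact: ideal0.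
- by apply: idealD (Sx _ SI) (Sy _ SI); case: SI.
- by apply: idealMl (Sx _ SI); case: SI.
Qed.

Lemma sub_ideal_gen (S : set R) : S `<=` ideal_gen S.
Proof. exact: sub_gen_smallest. Qed.

Lemma ideal_gen_sub (S I : set R) :
  is_ideal I -> S `<=` I -> ideal_gen S `<=` I.
Proof. exact: smallest_sub. Qed.

Lemma ideal_genS (S S' : set R) : S `<=` S' -> ideal_gen S `<=` ideal_gen S'.
Proof.
move=> sub; apply: ideal_gen_sub; first exact: ideal_gen_ideal.
exact: subset_trans sub (@sub_ideal_gen _).
Qed.

(** [I] need only be a submodule over the image of [f]; this is applied to
    modules over the Rees algebra, which are not ideals of [R[U][V]]. *)
Lemma ideal_preim (T : comPzRingType) (f : {rmorphism R -> T}) (I : set T) :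
  I 0 -> (forall u v, I u -> I v -> I (u + v)) ->
  (forall a u, I u -> I (f a * u)) -> is_ideal [set x | I (f x)].
Proof.
move=> I0 ID IM; split=> /= [|x y|a x]; rewrite ?rmorph0 ?rmorphD ?rmorphM //.
- exact: ID.
- exact: IM.
Qed.

Lemma ideal_colon I a : is_ideal I -> is_ideal [set x | I (a * x)].
Proof.
move=> idI; split=> /= [|x y|b x]; first by rewrite mulr0; apply: ideal0.
- by rewrite mulrDr; apply: idealD.
- by rewrite mulrCA; apply: idealMl.
Qed.

Lemma ideal_mul_ideal I J : is_ideal (ideal_mul I J).
Proof. exact: ideal_gen_ideal. Qed.

Lemma ideal_mulP I J x y : I x -> J y -> ideal_mul I J (x * y).
Proof. by move=> Ix Jy; apply: sub_ideal_gen; exists x => //; exists y. Qed.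

Lemma ideal_mul_sub I J K : is_ideal K ->
  (forall x y, I x -> J y -> K (x * y)) -> ideal_mul I J `<=` K.
Proof.
move=> idK IJK; apply: ideal_gen_sub => // _ [x Ix [y Jy <-]]; exact: IJK.
Qed.

Lemma ideal_mulS I I' J J' : I `<=` I' -> J `<=` J' ->
  ideal_mul I J `<=` ideal_mul I' J'.
Proof.
move=> sI sJ; apply: ideal_mul_sub; first exact: ideal_mul_ideal.
by move=> x y Ix Jy; apply: ideal_mulP; [apply: sI|apply: sJ].
Qed.

Lemma ideal_mul_subr I J : is_ideal J -> ideal_mul I J `<=` J.
Proof. by move=> idJ; apply: ideal_mul_sub => // x y _; apply: idealMl. Qed.

Lemma ideal_mul_mull I I' J a z : (forall x, I x -> I' (a * x)) ->
  ideal_mul I J z -> ideal_mul I' J (a * z).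
Proof.
move=> II'; apply: (ideal_mul_sub (K := [set z | ideal_mul I' J (a * z)])).
  exact/ideal_colon/ideal_mul_ideal.
by move=> x y Ix Jy /=; rewrite mulrA; apply: ideal_mulP => //; apply: II'.
Qed.

Lemma ideal_mul_mulr I J J' a z : (forall x, J x -> J' (a * x)) ->
  ideal_mul I J z -> ideal_mul I J' (a * z).
Proof.
move=> JJ'; apply: (ideal_mul_sub (K := [set z | ideal_mul I J' (a * z)])).
  exact/ideal_colon/ideal_mul_ideal.
by move=> x y Ix Jy /=; rewrite mulrCA; apply: ideal_mulP => //; apply: JJ'.
Qed.

Lemma ideal_exp_ideal I n : is_ideal (ideal_exp I n).
Proof. by case: n => [|n] //=; apply: ideal_mul_ideal. Qed.

Lemma ideal_expX I x n : I x -> ideal_exp I n (x ^+ n).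
Proof. by move=> Ix; elim: n => //= n IH; rewrite exprS; apply: ideal_mulP. Qed.

Lemma ideal_expM I m n x y :
  ideal_exp I m x -> ideal_exp I n y -> ideal_exp I (m + n) (x * y).
Proof.
elim: m x y => [|m IH] x y Ix Iy; first exact: idealMl (ideal_exp_ideal _ _) Iy.
rewrite mulrC addSn /=; apply: ideal_mul_mulr Ix => z Iz.
by rewrite mulrC; apply: IH.
Qed.

Lemma ideal_expS I J n : I `<=` J -> ideal_exp I n `<=` ideal_exp J n.
Proof. by move=> sub; elim: n => //= n IH; apply: ideal_mulS. Qed.

Lemma ideal_exp_leq I m n :
  (m <= n)%N -> ideal_exp I n `<=` ideal_exp I m.
Proof.
move=> /subnK <-; elim: (n - m)%N => //= k IH.
exact: subset_trans (ideal_mul_subr (ideal_exp_ideal _ _)) IH.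
Qed.

Lemma ideal_expT n : ideal_exp (setT : set R) n = setT.
Proof.
apply/seteqP; split=> // x _.
have := idealMl x (ideal_exp_ideal setT n) (ideal_expX n (I : setT (1 : R))).
by rewrite expr1n mulr1.
Qed.

Lemma ideal_mulT I : is_ideal I -> ideal_mul setT I = I.
Proof.
move=> idI; apply/seteqP; split; first exact: ideal_mul_subr.
by move=> x Ix; rewrite -[x]mul1r; apply: ideal_mulP.
Qed.

End Ideals.

(** * Chain conditions *)

Section Noetherian.
Variable R : comPzRingType.
Hypothesis R_noeth : noetherian R.

(** The union of the chain is an ideal, and each of its finitely many
    generators already occurs at a finite stage. *)
Lemma noetherian_chain (E : nat -> set R) :
  (forall n, is_ideal (E n)) -> (forall m n, (m <= n)%N -> E m `<=` E n) ->
  exists N, forall n, E n `<=` E N.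
Proof.
move=> idE mE; have idU : is_ideal (\bigcup_n E n).
  split; first by exists 0%N => //; apply: ideal0.
  - move=> x y [m _ Ex] [n _ Ey]; exists (maxn m n) => //.
    by apply: idealD => //; [apply: mE Ex|apply: mE Ey]; rewrite ?leq_maxl ?leq_maxr.
  - by move=> a x [m _ Ex]; exists m => //; apply: idealMl.
have [s Es] := R_noeth idU.
have [N sN] : exists N, forall x, x \in s -> E N x.
  have: forall x, x \in s -> (\bigcup_n E n) x.
    by move=> x sx; rewrite Es; apply: sub_ideal_gen.
  elim: s {Es} => [|a s IH] sE; first by exists 0%N.
  have [N sN] := IH (fun x sx => sE x (mem_behead (s := a :: s) sx)).
  have [m _ Ea] := sE a (mem_head _ _).
  exists (maxn m N) => x; rewrite inE => /predU1P[->|/sN].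
  - by apply: mE Ea; rewrite leq_maxl.
  - by apply: mE; rewrite leq_maxr.
exists N => n x Ex; suff: (\bigcup_n E n) `<=` E N by apply; exists n.
by rewrite Es; apply: ideal_gen_sub => // y; apply: sN.
Qed.

(** Otherwise, choosing strictly larger members of [F] again and again gives a
    chain that never stabilizes. *)
Lemma noetherian_max (F : set (set R)) (I0 : set R) :
  F `<=` @is_ideal R -> F I0 ->
  exists2 I, F I & forall J, F J -> I `<=` J -> J = I.
Proof.
move=> Fid FI0; apply: contrapT => noM.
have next I : exists J, F I -> [/\ F J, I `<=` J & J <> I].
  have [FI|?] := pselect (F I); last by exists I.
  apply: contrapT => noJ; apply: noM; exists I => // J FJ IJ.
  by apply: contrapT => JI; apply: noJ; exists J.
have [g gP] := choice next.
pose E n := iter n g I0.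
have FE n : F (E n) by elim: n => //= n /gP[].
have mE m n : (m <= n)%N -> E m `<=` E n.
  move=> /subnK <-; elim: (n - m)%N => //= k IH.
  by apply: subset_trans IH _; have [] := gP _ (FE (k + m)%N).
have [N EN] := noetherian_chain (fun n => Fid _ (FE n)) mE.
have [_ s ne] := gP _ (FE N).
by apply: ne; apply/seteqP; split=> //; apply: (EN N.+1).
Qed.

End Noetherian.

(** * Finitely generated algebras *)

(** The ideals [L m] of degree [m] coefficients of the elements of [E] of degree
    at most [m] increase, hence stabilize at some [N].  Lifts of generators of
    [L 0, ..., L N] generate [E]: they suffice to cancel the top coefficient
    of any element of [E], after multiplication by a power of the variable. *)
Lemma hilbert_basis (R : comNzRingType) : noetherian R -> noetherian {poly R}.
Proof.
move=> R_noeth E idE.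
pose L m : set R := [set r | exists p, [/\ E p, (size p <= m.+1)%N & p`_m = r]].
have idL m : is_ideal (L m).
  split=> [|x y [p [Ep sp <-]] [q [Eq sq <-]]|a x [p [Ep sp <-]]].
  - by exists 0; rewrite size_poly0 coef0; split=> //; apply: ideal0.
  - exists (p + q); rewrite coefD; split=> //; first exact: idealD.
    by rewrite (leq_trans (size_polyD _ _)) // geq_max sp.
  - exists (a%:P * p); rewrite coefCM; split=> //; first exact: idealMl.
    by rewrite mul_polyC (leq_trans (size_scale_leq _ _)).
have mL m n : (m <= n)%N -> L m `<=` L n.
  move=> mn x [p [Ep sp <-]]; exists (p * 'X^(n - m)).
  split; first exact: idealMr.
  - apply/leq_sizeP => j nj; rewrite coefMXn; case: ifP => // _.
    by apply: (leq_sizeP _ _ sp); rewrite ltn_subRL subnK.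
  - by rewrite coefMXn ltnNge leq_subr /= subKn.
have [N LN] := noetherian_chain R_noeth idL mL.
have lift m : exists2 s : seq {poly R}, [set` s] `<=` E &
    forall r, L m r ->
    exists p, [/\ ideal_gen [set` s] p, (size p <= m.+1)%N & p`_m = r].
  have [l Ll] := R_noeth _ (idL m).
  have /choice[h hP] r : exists p, L m r -> [/\ E p, (size p <= m.+1)%N & p`_m = r].
    have [[p ?]|?] := pselect (L m r); first by exists p.
    by exists 0.
  have lL r : r \in l -> L m r by move=> lr; rewrite Ll; apply: sub_ideal_gen.
  exists (map h l) => [_ /mapP[r /lL/hP[Eh _ _] ->] //|].
  pose K : set R :=
    [set r | exists p, [/\ ideal_gen [set` map h l] p, (size p <= m.+1)%N & p`_m = r]].
  suff: L m `<=` K by [].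
  rewrite Ll; apply: ideal_gen_sub => [|r lr]; last first.
    have [_ sh hr] := hP _ (lL _ lr); exists (h r); split=> //.
    by apply: sub_ideal_gen; apply: map_f.
  have idG := ideal_gen_ideal [set` map h l].
  split=> [|x y [p [Ep sp <-]] [q [Eq sq <-]]|a x [p [Ep sp <-]]].
  - by exists 0; rewrite size_poly0 coef0; split=> //; exact: ideal0 idG.
  - exists (p + q); rewrite coefD; split=> //; first exact: idealD idG Ep Eq.
    by rewrite (leq_trans (size_polyD _ _)) // geq_max sp.
  - exists (a%:P * p); rewrite coefCM; split=> //; first exact: idealMl idG Ep.
    by rewrite mul_polyC (leq_trans (size_scale_leq _ _)).
have [s sE sP] : exists2 s : seq {poly R}, [set` s] `<=` E &
    forall m r, (m <= N)%N -> L m r ->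
    exists p, [/\ ideal_gen [set` s] p, (size p <= m.+1)%N & p`_m = r].
  elim: N {LN} => [|k [s sE sP]].
    by have [s sE sP] := lift 0%N; exists s => // m r; rewrite leqn0 => /eqP ->; apply: sP.
  have [s' sE' sP'] := lift k.+1; exists (s ++ s').
    by move=> p /=; rewrite mem_cat => /orP[/sE|/sE'].
  move=> m r; rewrite leq_eqVlt => /predU1P[->|mk] Lr.
  - have [p [gp sp pr]] := sP' _ Lr; exists p; split=> //.
    by apply: ideal_genS gp => q /= sq; rewrite mem_cat sq orbT.
  - have [p [gp sp pr]] := sP _ _ mk Lr; exists p; split=> //.
    by apply: ideal_genS gp => q /= sq; rewrite mem_cat sq.
exists s; apply/seteqP; split; last exact: ideal_gen_sub.
have idG := ideal_gen_ideal [set` s].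
suff H n (f : {poly R}) : (size f <= n)%N -> E f -> ideal_gen [set` s] f.
  by move=> f; apply: H (leqnn _).
elim: n f => [|n IH] f sf Ef.
  by move: sf; rewrite leqn0 size_poly_eq0 => /eqP ->; exact: ideal0 idG.
have Lf : L (minn n N) f`_n.
  have Lf : L n f`_n by exists f.
  by have [nN|Nn] := leqP n N => //; apply: LN Lf.
have [p [gp sp pf]] := sP _ _ (geq_minr _ _) Lf.
(* [q] has the same coefficient of degree [n] as [f]. *)
pose q := p * 'X^(n - minn n N).
have gq : ideal_gen [set` s] q by exact: idealMr idG gp.
rewrite -(subrK q f); apply: (idealD idG _ gq); apply: IH; last first.
  by apply: idealD => //; apply: idealN => //; apply: ideal_gen_sub gq.
apply/leq_sizeP => j; rewrite leq_eqVlt coefB /q coefMXn => /predU1P[<-|nj].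
  by rewrite ltnNge leq_subr /= subKn ?geq_minl// pf subrr.
rewrite (leq_sizeP _ _ sf) //; case: ifP => _; rewrite ?subr0 // sub0r.
by rewrite (leq_sizeP _ _ sp) ?oppr0// ltn_subRL subnK ?geq_minl.
Qed.

(** These are the subalgebras of [T]: the element [-1] is in the image of
    [iota], so closure under opposites follows. *)
Definition subalgebra (R T : comNzRingType) (iota : {rmorphism R -> T})
    (B : set T) : Prop :=
  [/\ forall r, B (iota r),
      forall x y, B x -> B y -> B (x + y)
    & forall x y, B x -> B y -> B (x * y)].

(** The subalgebra generated by [ts] is presented as the image of a noetherian
    ring; each generator costs one polynomial variable. *)
Lemma noetherian_fg_subalgebra (R T : comNzRingType)
    (iota : {rmorphism R -> T}) (ts : seq T) : noetherian R ->
  exists (S : comNzRingType) (phi : {rmorphism S -> T}),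
    [/\ noetherian S, subalgebra iota (range phi), [set` ts] `<=` range phi
      & forall B, subalgebra iota B -> [set` ts] `<=` B -> range phi `<=` B].
Proof.
move=> R_noeth; elim: ts => [|t ts [S [phi [S_noeth [phiR phiD phiM] phits phimin]]]].
  exists R, iota; split=> //.
  - split=> [r|_ _ [x _ <-] [y _ <-]|_ _ [x _ <-] [y _ <-]]; first by exists r.
    + by exists (x + y) => //; rewrite rmorphD.
    + by exists (x * y) => //; rewrite rmorphM.
  - by move=> B [BR _ _] _ _ [r _ <-].
have cphi : commr_rmorph phi t by move=> x; apply: mulrC.
pose psi : {rmorphism {poly S} -> T} := horner_morph cphi.
have phipsi : range phi `<=` range psi.
  by move=> _ [x _ <-]; exists x%:P => //; apply: horner_morphC.
exists {poly S}, psi; split; first exact: hilbert_basis.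
- split=> [r|_ _ [x _ <-] [y _ <-]|_ _ [x _ <-] [y _ <-]]; first exact/phipsi.
  + by exists (x + y) => //; rewrite rmorphD.
  + by exists (x * y) => //; rewrite rmorphM.
- move=> u /=; rewrite inE => /predU1P[->|tsu]; last exact/phipsi/phits.
  by exists 'X => //; apply: horner_morphX.
- move=> B subB tB; have [BR BD BM] := subB.
  (* The polynomials whose coefficients lie in [Y] form a module over the Rees
   algebra: it suffices to check stability under constants and generators. *)
have Bphi : range phi `<=` B.
    by apply: phimin => // u tsu; apply: tB; rewrite /= inE tsu orbT.
  move=> _ [p _ <-]; elim/poly_ind: p => [|p c Bp].
    by rewrite rmorph0 -(rmorph0 iota).
  rewrite rmorphD rmorphM /=; apply: BD; last first.
    by apply: Bphi; exists c => //; rewrite /= horner_morphC.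
  by apply: BM => //; rewrite /= horner_morphX; apply: tB; rewrite /= mem_head.
Qed.

Section Rees.
Variable R : comNzRingType.
Implicit Types (I A : set R) (Y : nat -> nat -> set R).

(** The monomial [z U^p V^q] of [R[U][V]], with [U] the inner variable. *)
Definition monom2 (z : R) (p q : nat) : {poly {poly R}} :=
  (z *: 'X^p) *: 'X^q.

Lemma coef_monom2 z p q i j :
  (monom2 z p q)`_j`_i = if (i == p) && (j == q) then z else 0.
Proof.
rewrite /monom2 coefZ coefXn andbC; case: eqP => _ /=; last by rewrite mulr0 coef0.
by rewrite mulr1 coefZ coefXn; case: eqP => _; rewrite ?mulr1 ?mulr0.
Qed.

Lemma monom2D y z p q : monom2 (y + z) p q = monom2 y p q + monom2 z p q.
Proof. by rewrite /monom2 !scalerDl. Qed.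

Lemma monom2M y z p q p' q' :
  monom2 (y * z) (p + p') (q + q') = monom2 y p q * monom2 z p' q'.
Proof.
by rewrite /monom2; do 2!rewrite -scalerAl -scalerAr scalerA -exprD.
Qed.

(** A bigraded module over the Rees algebra, the sum of the [I^p A^q U^p V^q],
    given by its components; it suffices to ask for stability under the
    elements of bidegree [(1, 0)] and [(0, 1)]. *)
Definition bigraded_module I A Y : Prop :=
  [/\ forall p q, is_ideal (Y p q),
      forall p q a z, I a -> Y p q z -> Y p.+1 q (a * z)
    & forall p q a z, A a -> Y p q z -> Y p q.+1 (a * z)].

(** The homogeneous subsets [E n] of the Rees algebra generate the same bigraded
    submodule as finitely many of them.  The Rees algebra is a finitely
    generated subalgebra of [R[U][V]], hence the image of a noetherian ring,
    where the ideals [ideal_gen (W k)] generated by the preimages of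
    [E 0, ..., E k] stabilize.  Testing against all modules [Y] avoids writing
    down the submodule that is generated. *)
Lemma rees_noetherian I A (E : nat -> set R) (dp dq : nat -> nat) :
  noetherian R -> is_ideal I -> is_ideal A ->
  (forall n, E n `<=` ideal_mul (ideal_exp A (dq n)) (ideal_exp I (dp n))) ->
  exists N, forall Y, bigraded_module I A Y ->
    (forall n, (n <= N)%N -> E n `<=` Y (dp n) (dq n)) ->
    forall n, E n `<=` Y (dp n) (dq n).
Proof.
move=> R_noeth idI idA EIA.
have [fs Ifs] := R_noeth _ idI; have [gs Ags] := R_noeth _ idA.
pose iota : {rmorphism R -> {poly {poly R}}} := polyC \o polyC.
pose ts := [seq monom2 f 1 0 | f <- fs] ++ [seq monom2 g 0 1 | g <- gs].
have [S [phi [S_noeth subphi phits phimin]]] :=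
  noetherian_fg_subalgebra iota ts R_noeth.
have iotaE a : iota a = monom2 a 0 0.
  by rewrite /iota /monom2 /= !expr0 !alg_polyC.
have idphi p q : is_ideal [set z | range phi (monom2 z p q)].
  have [phiR phiD phiM] := subphi.
  split=> /= [|x y|a x].
  - have -> : monom2 0 p q = iota 0 by rewrite /monom2 !scale0r rmorph0.
    exact: phiR.
  - by rewrite monom2D; apply: phiD.
  - by rewrite -[p]add0n -[q]add0n monom2M -iotaE; apply: phiM.
have phiM := let: And3 _ _ h := subphi in h.
have phiI p z : ideal_exp I p z -> range phi (monom2 z p 0).
  elim: p z => [|p IH] z.
    by move=> _; rewrite -iotaE; have [phiR _ _] := subphi; apply: phiR.
  apply: (ideal_mul_sub (K := [set z | range phi (monom2 z p.+1 0)])) => // x y Ix Iy /=.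
  rewrite -[p.+1]add1n -[X in monom2 _ _ X]addn0 monom2M; apply: phiM; last exact: IH.
  move: Ix; rewrite Ifs.
  apply: (ideal_gen_sub (I := [set z | range phi (monom2 z 1 0)])) => // f fsf.
  by apply: phits; rewrite /= mem_cat (map_f (fun f => monom2 f 1 0)).
have phiA q z : ideal_exp A q z -> range phi (monom2 z 0 q).
  elim: q z => [|q IH] z.
    by move=> _; rewrite -iotaE; have [phiR _ _] := subphi; apply: phiR.
  apply: (ideal_mul_sub (K := [set z | range phi (monom2 z 0 q.+1)])) => // x y Ax Ay /=.
  rewrite -[q.+1]add1n -[X in monom2 _ X _]addn0 monom2M; apply: phiM; last exact: IH.
  move: Ax; rewrite Ags.
  apply: (ideal_gen_sub (I := [set z | range phi (monom2 z 0 1)])) => // g gsg.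
  by apply: phits; rewrite /= mem_cat orbC (map_f (fun g => monom2 g 0 1)).
have phiIA p q : ideal_mul (ideal_exp A q) (ideal_exp I p)
    `<=` [set z | range phi (monom2 z p q)].
  apply: ideal_mul_sub => // x y /phiA xA /phiI yI /=.
  by rewrite -[p]add0n -[q]addn0 monom2M; apply: phiM.
pose W k := [set s | exists n z, [/\ (n <= k)%N, E n z & phi s = monom2 z (dp n) (dq n)]].
have mW m n : (m <= n)%N -> ideal_gen (W m) `<=` ideal_gen (W n).
  move=> mn; apply: ideal_genS => s [k [z [km Ez e]]].
  by exists k, z; split=> //; apply: leq_trans km mn.
have [N EN] := noetherian_chain S_noeth (fun k => ideal_gen_ideal (W k)) mW.
exists N => Y [idY IY AY] YE n z Enz.
have [s _ sz] := phiIA _ _ _ (EIA _ _ Enz).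
pose Yt : set {poly {poly R}} := [set P : {poly {poly R}} | forall p q, Y p q P`_q`_p].
pose B := [set t : {poly {poly R}} | Yt `<=` [set P : {poly {poly R}} | Yt (t * P)]].
have YD P Q : Yt P -> Yt Q -> Yt (P + Q).
  by move=> YP YQ p q; rewrite !coefD; apply: idealD.
have Bphi : range phi `<=` B.
  apply: phimin; first split.
  - by move=> r P YP p q; rewrite /iota /= !coefCM; apply: idealMl.
  - by move=> x y Bx By P YP; rewrite /= mulrDl; apply: YD; [apply: Bx|apply: By].
  - by move=> x y Bx By P YP; rewrite /= -mulrA; apply: Bx; apply: By.
  - move=> t; rewrite /= mem_cat => /orP[/mapP[f fsf ->]|/mapP[g gsg ->]] P YP p q.
    + rewrite /monom2 expr0 expr1 -scalerAl mul1r coefZ -scalerAl coefZ coefXM.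
      case: p => [|p] /=; first by rewrite mulr0; apply: ideal0.
      by apply: IY => //; rewrite Ifs; apply: sub_ideal_gen.
    + rewrite /monom2 expr0 expr1 -scalerAl coefZ coefXM -scalerAl mul1r coefZ.
      case: q => [|q] /=; first by rewrite coef0 mulr0; apply: ideal0.
      by apply: AY => //; rewrite Ags; apply: sub_ideal_gen.
have: Yt (phi s).
  have /EN : ideal_gen (W n) s by apply: sub_ideal_gen; exists n, z.
  apply: (ideal_gen_sub (I := [set s | Yt (phi s)])).
    apply: ideal_preim => // [p q|a P]; first by rewrite !coef0; apply: ideal0.
    by apply: Bphi; exists a.
  move=> r [m [y [mN Ey e]]] p q; rewrite e coef_monom2.
  by case: andP => [[/eqP -> /eqP ->]|_]; [apply: YE Ey|apply: ideal0].
by rewrite sz => /(_ (dp n) (dq n)); rewrite coef_monom2 !eqxx.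
Qed.

End Rees.

(** * Minimal primes *)

Section Primes.
Variable R : comPzRingType.
Implicit Types (P Q I : set R) (Ps : seq (set R)) (x y c d : R).

Lemma prime_ideal_is_ideal P : prime_ideal P -> is_ideal P.
Proof. by case. Qed.

Lemma prime_idealX P x n : prime_ideal P -> P (x ^+ n) -> P x.
Proof.
by case=> _ P1 PM; elim: n => [/P1|n IH] //; rewrite exprS => /PM[].
Qed.

Lemma prime_ideal_prod P (T : eqType) (r : seq T) (F : T -> R) :
  prime_ideal P -> P (\prod_(i <- r) F i) -> exists2 i, i \in r & P (F i).
Proof.
case=> _ P1 PM; elim: r => [|a r IH]; first by rewrite big_nil => /P1.
rewrite big_cons => /PM[Pa|/IH[i ri Pi]]; first by exists a; rewrite ?mem_head.
by exists i; rewrite // inE ri orbT.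
Qed.

Lemma avoids1 : avoids_minimal_primes (1 : R).
Proof. by move=> P [[]]. Qed.

Lemma avoidsM c d : avoids_minimal_primes c -> avoids_minimal_primes d ->
  avoids_minimal_primes (c * d).
Proof. by move=> hc hd P mP; have [[_ _ PM] _] := mP => /PM[/hc|/hd]; apply. Qed.

Lemma avoidsX c n : avoids_minimal_primes c -> avoids_minimal_primes (c ^+ n).
Proof. by move=> hc P mP /(prime_idealX mP.1); apply: hc. Qed.

Lemma setT_positive_height : positive_height (setT : set R).
Proof. by move=> P [[_ P1 _] _] /(_ 1 Logic.I)/P1. Qed.

Hypothesis R_noeth : noetherian R.

(** Noetherian induction: an ideal [Q] maximal among the counterexamples is
    prime, because [a b] in [Q] gives [(Q + a)(Q + b) <= Q], so that the primes
    found for [Q + a] and [Q + b] together serve for [Q]. *)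
Lemma radical_finite_primes Q : is_ideal Q ->
  exists2 Ps : seq (set R), (forall P, P \in Ps -> prime_ideal P) &
    forall x, (forall P, P \in Ps -> P x) -> exists n, Q (x ^+ n).
Proof.
move=> idQ0; apply: contrapT => bad0.
pose F : set (set R) := [set Q | is_ideal Q /\
  ~ (exists2 Ps : seq (set R), (forall P, P \in Ps -> prime_ideal P) &
    forall x, (forall P, P \in Ps -> P x) -> exists n, Q (x ^+ n))].
have [{bad0 idQ0}Q [idQ badQ] maxQ] :=
  noetherian_max R_noeth (fun J (FJ : F J) => FJ.1) (conj idQ0 bad0 : F Q).
have grow a : ~ Q a ->
    exists2 Ps : seq (set R), (forall P, P \in Ps -> prime_ideal P) &
    forall x, (forall P, P \in Ps -> P x) ->
    exists n, ideal_gen (Q `|` [set a]) (x ^+ n).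
  move=> Qa; apply: contrapT => badQa; apply: Qa.
  have <- : ideal_gen (Q `|` [set a]) = Q.
    apply: maxQ; first by split=> //; apply: ideal_gen_ideal.
    by move=> x Qx; apply: sub_ideal_gen; left.
  by apply: sub_ideal_gen; right.
apply: (badQ); exists [:: Q]; last by move=> x /(_ _ (mem_head _ _)); exists 1%N.
move=> Q'; rewrite inE => /eqP ->; split=> // [Q1|a b Qab].
  by apply: badQ; exists [::] => // x _; exists 0%N.
apply: contrapT => /not_orP[/grow[Ps1 pr1 cut1] /grow[Ps2 pr2 cut2]].
apply: badQ; exists (Ps1 ++ Ps2) => [P|x Px].
  by rewrite mem_cat => /orP[/pr1|/pr2].
have [|m xm] := cut1 x; first by move=> P P1; apply: Px; rewrite mem_cat P1.
have [|n xn] := cut2 x; first by move=> P P2; apply: Px; rewrite mem_cat P2 orbT.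
exists (m + n)%N; rewrite exprD.
apply: (ideal_gen_sub (ideal_colon (x ^+ m) idQ) _ xn) => y [|->] /=.
  exact: idealMl.
rewrite mulrC; apply: (ideal_gen_sub (ideal_colon b idQ) _ xm) => z [|->] /=.
  exact: idealMl.
by rewrite mulrC.
Qed.

(** If each [P] had an element outside [Q], the product of these elements would
    be nilpotent and yet outside [Q]. *)
Lemma prime_contains Ps Q : prime_ideal Q ->
  (forall x, (forall P, P \in Ps -> P x) -> exists n, x ^+ n = 0) ->
  (forall P, P \in Ps -> is_ideal P) ->
  exists2 P, P \in Ps & P `<=` Q.
Proof.
move=> prQ cut idPs; apply: contrapT => noP.
have /choice[h hP] P : exists e, P \in Ps -> P e /\ ~ Q e.
  have [PPs|?] := boolP (P \in Ps); last by exists 0.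
  apply: contrapT => noe; apply: noP; exists P => // e Pe.
  by apply: contrapT => Qe; apply: noe; exists e.
have [P PPs|n e0] := cut (\prod_(P <- Ps) h P).
  rewrite (perm_big _ (perm_to_rem PPs)) big_cons.
  by apply: idealMr; [apply: idPs|case: (hP _ PPs)].
have : Q (\prod_(P <- Ps) h P).
  by apply: (prime_idealX (n := n)) => //; rewrite e0; apply: ideal0; case: prQ.
by case/(prime_ideal_prod prQ) => P /hP[].
Qed.

(** Finitely many primes cut out the nilradical; one that is not minimal
    contains another one of the list and can be discarded. *)
Lemma finite_minimal_primes :
  exists2 Ps : seq (set R), (forall P, P \in Ps -> minimal_prime P) &
    forall x, (forall P, P \in Ps -> P x) -> exists n, x ^+ n = 0.
Proof.
have id0 : is_ideal [set 0 : R].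
  by split=> [//|x y -> ->|a x ->] /=; rewrite ?addr0 ?mulr0.
have [Ps] := radical_finite_primes id0.
have [n] := ubnP (size Ps); elim: n Ps => // n IH Ps sPs prPs cut.
have [allmin|] := pselect (forall P, P \in Ps -> minimal_prime P).
  by exists Ps.
move=> /existsNP[P /not_implyP[PPs nminP]].
have [Q [prQ QP neQ]] : exists Q, [/\ prime_ideal Q, Q `<=` P & Q <> P].
  apply: contrapT => noQ; apply: nminP; split=> [|Q prQ QP]; first exact: prPs.
  by apply: contrapT => neQ; apply: noQ; exists Q.
have [P0 P0Ps P0Q] := prime_contains prQ cut
  (fun P h => prime_ideal_is_ideal (prPs P h)).
have P0P : P0 != P.
  by apply/eqP => e; apply: neQ; apply/seteqP; split=> //; rewrite -e.
apply: (IH [seq P' <- Ps | P' != P]) => [|P'|x xP].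
- rewrite -ltnS (leq_trans _ sPs) // ltnS size_filter.
  rewrite -(count_predC (pred1 P) Ps) -[X in (X <= _)%N]add1n leq_add2r.
  by rewrite -has_count has_pred1.
- by rewrite mem_filter => /andP[_ /prPs].
- apply: cut => P' P'Ps; have [->|neP] := eqVneq P' P; last first.
    by apply: xP; rewrite mem_filter neP.
  by apply: QP; apply: P0Q; apply: xP; rewrite mem_filter P0P.
Qed.

Lemma avoids_annihilator_nilpotent c x :
  avoids_minimal_primes c -> c * x = 0 -> exists n, x ^+ n = 0.
Proof.
move=> hc cx; have [Ps minPs cut] := finite_minimal_primes.
apply: cut => P /minPs minP; have [[idP _ PM] _] := minP.
have : P (c * x) by rewrite cx; apply: ideal0.
by case/PM => // Pc; case: (hc P).
Qed.

(** Prime avoidance, one minimal prime at a time.  If [d] avoids the previous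
    primes but lies in [P], add to it an element [z] of [I] outside [P] that
    lies in all the previous primes; since [P] is minimal, none of these is
    contained in [P], which provides the factors of [z]. *)
Lemma positive_height_avoids I : is_ideal I -> positive_height I ->
  exists2 d, I d & avoids_minimal_primes d.
Proof.
move=> idI htI; have [Ps minPs cut] := finite_minimal_primes.
suff [d Id dPs] : exists2 d, I d & forall P, P \in Ps -> ~ P d.
  exists d => // Q [prQ minQ].
  have [P PPs PQ] := prime_contains prQ cut
    (fun P h => prime_ideal_is_ideal (minPs P h).1).
  by rewrite -(minQ P) //; [apply: dPs|case: (minPs P PPs)].
elim: Ps minPs {cut} => [|P Ps IH] minPs; first by exists 0 => //; apply: ideal0.
have {IH}[P' /(mem_behead (s := P :: Ps))/minPs //|d Id dPs] := IH.
have minP := minPs _ (mem_head _ _); have [prP _] := minP.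
have [idP P1 PM] := prP.
have [Pd|nPd] := pselect (P d); last first.
  by exists d => // P'; rewrite inE => /predU1P[->|/dPs].
have nPPs : P \notin Ps by apply/negP => /dPs.
have /choice[h hP] Q : exists e, Q \in Ps -> Q e /\ ~ P e.
  have [QPs|?] := boolP (Q \in Ps); last by exists 0.
  apply: contrapT => noe; move: nPPs; rewrite -(minP.2 Q) ?QPs//.
    by case: (minPs Q) => //; rewrite inE QPs orbT.
  by move=> e Qe; apply: contrapT => Pe; apply: noe; exists e.
have [e Ie nPe] : exists2 e, I e & ~ P e.
  apply: contrapT => noe; apply: (htI P minP) => e Ie.
  by apply: contrapT => Pe; apply: noe; exists e.
pose z := e * \prod_(Q <- Ps) h Q.
have nPz : ~ P z.
  by case/PM => // /(prime_ideal_prod prP)[Q /hP[]].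
exists (d + z) => [|P']; first by apply: idealD => //; apply: idealMr.
rewrite inE => /predU1P[->|P'Ps].
  by move=> Pdz; apply: nPz; rewrite -[z](addKr d); apply: idealD => //; apply: idealN.
have idP' : is_ideal P'.
  by apply: prime_ideal_is_ideal (minPs P' _).1; rewrite inE P'Ps orbT.
have P'z : P' z.
  apply: idealMl => //; rewrite (perm_big _ (perm_to_rem P'Ps)) big_cons.
  by apply: idealMr => //; case: (hP _ P'Ps).
move=> P'dz; apply: (dPs _ P'Ps); rewrite -[d](addrK z).
by apply: idealD => //; apply: idealN.
Qed.

End Primes.

(** * Integral closure *)

Section IntegralClosure.
Variable R : comPzRingType.
Implicit Types (I A : set R) (x y z c : R).

Definition ideal_adjoin I x : set R := ideal_gen (I `|` [set x]).

Lemma sub_ideal_adjoin I x : I `<=` ideal_adjoin I x.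
Proof. by move=> y Iy; apply: sub_ideal_gen; left. Qed.

Lemma mem_ideal_adjoin I x : ideal_adjoin I x x.
Proof. by apply: sub_ideal_gen; right. Qed.

Lemma ideal_preimM I b c :
  is_ideal I -> is_ideal [set v | exists2 w, I w & b * v = c * w].
Proof.
move=> idI; split=> [|u v [w Iw e] [w' Iw' e']|a v [w Iw e]] /=.
- by exists 0; rewrite ?mulr0//; apply: ideal0.
- by exists (w + w'); rewrite ?mulrDr ?e ?e'//; apply: idealD.
- by exists (a * w); rewrite 1?mulrCA ?e 1?mulrCA//; apply: idealMl.
Qed.

(** With [J = I + (x)]: [J^k = (x^k) + I J^(k-1)], so that stability under [J^k]
    only has to be checked on [x^k]. *)
Lemma ideal_adjoin_exp I x k z :
  ideal_exp (ideal_adjoin I x) k z ->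
  exists r, exists2 w, ideal_mul I (ideal_exp (ideal_adjoin I x) k.-1) w &
    z = r * x ^+ k + w.
Proof.
set J := ideal_adjoin I x.
pose D k : set R :=
  [set z | exists r, exists2 w, ideal_mul I (ideal_exp J k.-1) w & z = r * x ^+ k + w].
have idD n : is_ideal (D n).
  have idIJ := ideal_mul_ideal I (ideal_exp J n.-1).
  split=> [|u v [r [w Iw ->]] [r' [w' Iw' ->]]|a u [r [w Iw ->]]].
  - by exists 0, 0; rewrite ?mul0r ?addr0//; apply: ideal0 idIJ.
  - exists (r + r'), (w + w'); first exact: idealD idIJ Iw Iw'.
    by rewrite mulrDl addrACA.
  - exists (a * r), (a * w); first exact: idealMl idIJ Iw.
    by rewrite mulrDr mulrA.
suff: ideal_exp J k `<=` D k by apply.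
elim: k {z} => [|k IH] z.
  by exists z, 0; rewrite ?mulr1 ?addr0//; apply: ideal0; apply: ideal_mul_ideal.
apply: (ideal_mul_sub (idD k.+1)) => u v Ju Jv; rewrite mulrC.
apply: (ideal_gen_sub (ideal_colon v (idD k.+1)) _ Ju) => {Ju}u [Iu|->] /=.
  by exists 0, (v * u); rewrite ?mul0r ?add0r// mulrC; apply: ideal_mulP.
have [r [w Iw ->]] := IH _ Jv; exists r, (x * w).
  case: k Iw {IH Jv} => [|k] /=; first by apply: idealMl; apply: ideal_mul_ideal.
  apply: ideal_mul_mulr => y Jy; apply: ideal_mulP => //; exact: mem_ideal_adjoin.
by rewrite mulrDl -mulrA -exprSr [w * x]mulrC.
Qed.

(** For [m = 0] this is [(I + (x))^k]; membership of [x^k] for [m = 1] is an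
    equation of integral dependence of degree [k]. *)
Definition graded_sums I x m k : set R :=
  [set z | exists2 a : nat -> R, forall i, ideal_exp I i (a i) &
     z = \sum_(m <= i < k.+1) a i * x ^+ (k - i)].

Lemma graded_sums_ideal I x m k : is_ideal (graded_sums I x m k).
Proof.
have idE i := ideal_exp_ideal I i.
split=> [|u v [a Ia ->] [b Ib ->]|r u [a Ia ->]].
- exists (fun=> 0) => [i|]; first exact: ideal0 (idE i).
  by rewrite big1 // => i _; rewrite mul0r.
- exists (fun i => a i + b i) => [i|]; first exact: idealD (idE i) (Ia i) (Ib i).
  by rewrite -big_split; apply: eq_bigr => i _; rewrite mulrDl.
- exists (fun i => r * a i) => [i|]; first exact: idealMl (idE i) (Ia i).
  by rewrite big_distrr; apply: eq_bigr => i _; rewrite /= mulrA.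
Qed.

Lemma graded_sums_shift I x k b z :
  I b -> graded_sums I x 0 k z -> graded_sums I x 1 k.+1 (b * z).
Proof.
move=> Ib [a Ia ->]; exists (fun i => if i is j.+1 then b * a j else 0).
  by case=> [|i] //=; apply: ideal_mulP.
by rewrite big_add1 big_distrr; apply: eq_bigr => i _ /=; rewrite mulrA subSS.
Qed.

Lemma graded_sums10 I x k : graded_sums I x 1 k `<=` graded_sums I x 0 k.
Proof.
move=> _ [a Ia ->]; exists (fun i => if i is 0 then 0 else a i).
  by case=> [|i] //.
rewrite [RHS]big_nat_recl // mul0r add0r big_add1 /=.
by apply: eq_bigr.
Qed.

Lemma ideal_adjoin_exp_sums I x k :
  ideal_exp (ideal_adjoin I x) k `<=` graded_sums I x 0 k.
Proof.
elim: k => [|k IH] z.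
  move=> _; exists (fun i => if i is 0 then z else 0).
    by case=> [|i] //; apply: (ideal0 (ideal_exp_ideal I i.+1)).
  by rewrite big_nat1 mulr1.
have idG := graded_sums_ideal I x 0 k.+1.
apply: (ideal_mul_sub idG) => u v Ju /IH Gv; rewrite mulrC.
apply: (ideal_gen_sub (ideal_colon v idG) _ Ju) => {Ju}u [Iu|->] /=.
  by apply: graded_sums10; rewrite mulrC; apply: graded_sums_shift.
case: Gv => a Ia ->; exists (fun i => if i == k.+1 then 0 else a i).
  by move=> i; case: eqP => // ->; apply: (ideal0 (ideal_exp_ideal I k.+1)).
rewrite [RHS]big_nat_recr //= eqxx mul0r addr0 mulrC big_distrr /=.
apply: eq_big_nat => i /andP[_ ik]; rewrite mulrCA -exprS subSn //.
by rewrite ltn_eqF.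
Qed.

(** [I] being a reduction of [I + (x)] makes [x] integral over [I]. *)
Lemma reduction_integral I x k :
  ideal_mul I (ideal_exp (ideal_adjoin I x) k) (x ^+ k.+1) ->
  integral_closure I x.
Proof.
have idG := graded_sums_ideal I x 1 k.+1.
move=> /(ideal_mul_sub idG (fun b z Ib Jz =>
  graded_sums_shift Ib (ideal_adjoin_exp_sums Jz)))[a Ia e].
exists k.+1 => //; exists (fun i => - a i).
  by move=> i _; apply: idealN (Ia i); apply: ideal_exp_ideal.
by rewrite e -big_split big1 // => i _; rewrite /= mulNr subrr.
Qed.

(** The integral equation of degree [k] expresses [x^n] by the terms
    [a_i x^(n-i)], and [i + (n - i - k)] is at least [n - k]. *)
Lemma integral_exp I x : integral_closure I x ->
  exists k, forall n, ideal_exp I (n - k) (x ^+ n).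
Proof.
move=> [k k0 [a Ia e]]; exists k => n.
have [m] := ubnP n; elim: m n => // m IH n; rewrite ltnS => nm.
have [nk|kn] := ltnP n k.
  by have /eqP -> : (n - k == 0)%N by rewrite subn_eq0 ltnW.
have idE := ideal_exp_ideal I (n - k).
have /eqP := e; rewrite addr_eq0 => /eqP xk.
rewrite -{2}(subnK kn) exprD xk mulrN; apply: (idealN idE); rewrite big_distrr big_nat.
apply: (ideal_sum _ idE) => i; rewrite ltnS => /andP[i1 ik] /=.
rewrite mulrCA -exprD; set j := (n - k + (k - i))%N.
apply: (@ideal_exp_leq _ _ _ (i + (j - k))); first by rewrite /j; lia.
by apply: ideal_expM; [apply: Ia; rewrite i1|apply: IH; rewrite /j; lia].
Qed.

End IntegralClosure.

(** The bigraded family [Y] with components [c A^q K p] contains the generators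
    [c x^n A^(a n)] for [n <= N], because [x^n] is in [K n = J^n].  Beyond [N]
    the components are [K p = I J^(p-1)], so the conclusion is that [Y] contains
    the generator of index [N+1]. *)
Lemma stable_reduction_nz (R : comNzRingType) (I A : set R) (c x : R)
    (a : nat -> nat) (n0 : nat) :
  noetherian R -> is_ideal I -> is_ideal A ->
  (forall n y, (n0 <= n)%N -> ideal_exp A (a n) y ->
    ideal_mul (ideal_exp A (a n)) (ideal_exp I n) (c * x ^+ n * y)) ->
  exists N, forall y, ideal_exp A (a N.+1) y ->
    exists2 w, ideal_mul (ideal_exp A (a N.+1))
                 (ideal_mul I (ideal_exp (ideal_adjoin I x) N)) w &
      c * x ^+ N.+1 * y = c * w.
Proof.
move=> R_noeth idI idA cx; set J := ideal_adjoin I x.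
pose E n := [set z | (n0 <= n)%N /\ exists2 y, ideal_exp A (a n) y & z = c * x ^+ n * y].
have [n|N0 N0P] := rees_noetherian (E := E) (dp := id) (dq := a) R_noeth idI idA.
  by move=> _ [n0n [y Ay ->]]; apply: cx.
pose N := maxn N0 n0; exists N => y Ay.
pose K p : set R := if (p <= N)%N then ideal_exp J p else ideal_mul I (ideal_exp J p.-1).
have idK p : is_ideal (K p).
  by rewrite /K; case: ifP => _; [apply: ideal_exp_ideal|apply: ideal_mul_ideal].
have IK p b z : I b -> K p z -> K p.+1 (b * z).
  rewrite /K => Ib; have [pN|Np|->] := ltngtP p N.
  - by move=> Jz; apply: ideal_mulP => //; apply: sub_ideal_adjoin.
  - case: p Np => // p _ /= Jz; apply: ideal_mulP => //.
    apply: ideal_mulS Jz => //; exact: sub_ideal_adjoin.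
  - exact: ideal_mulP.
(* The factor 1 gives [Y p q] the form treated by [ideal_preimM]. *)
pose Y p q : set R :=
  [set z | exists2 w, ideal_mul (ideal_exp A q) (K p) w & 1 * z = c * w].
have : Y N.+1 (a N.+1) (c * x ^+ N.+1 * y).
  apply: (N0P Y); last by split; [rewrite (leq_trans (leq_maxr N0 n0))|exists y].
    split=> [p q|p q b z Ib [w Kw e]|p q b z Ab [w Kw e]].
    - by apply: ideal_preimM; apply: ideal_mul_ideal.
    - exists (b * w); last by rewrite mulrCA e mulrCA.
      by apply: ideal_mul_mulr Kw => u; apply: IK.
    - exists (b * w); last by rewrite mulrCA e mulrCA.
      by apply: ideal_mul_mull Kw => u Au; apply: ideal_mulP.
  move=> n nN0 _ [_ [u Au ->]]; exists (u * x ^+ n); last first.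
    by rewrite mul1r -mulrA [x ^+ n * u]mulrC.
  apply: ideal_mulP => //; rewrite /K (leq_trans nN0) ?leq_maxl//.
  by apply: ideal_expX; apply: mem_ideal_adjoin.
by rewrite /Y /K ltnn /= mul1r.
Qed.

(** [{poly R}] needs a nonzero ring.  Destructuring the class makes the
    repackaged ring equal to [R] on the nose, so that statements about ideals
    transfer by rewriting. *)
Lemma comPzRing_nontrivial (R : comPzRingType) :
  1 != 0 :> R -> exists R' : comNzRingType, R' = R :> comPzRingType.
Proof.
case: R => T [m1 m2 m3 m4 m5 m6 m7 m8 m9 m10 m11] R1.
pose R := GRing.ComPzRing.Pack (GRing.ComPzRing.Class m4 m11).
pose R' : comNzRingType :=
  HB.pack T (GRing.ComPzRing.class R) (GRing.PzSemiRing_isNonZero.Build R R1).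
by exists R'.
Qed.

Lemma stable_reduction (R : comPzRingType) (I A : set R) (c x : R)
    (a : nat -> nat) (n0 : nat) :
  noetherian R -> is_ideal I -> is_ideal A ->
  (forall n y, (n0 <= n)%N -> ideal_exp A (a n) y ->
    ideal_mul (ideal_exp A (a n)) (ideal_exp I n) (c * x ^+ n * y)) ->
  exists N, forall y, ideal_exp A (a N.+1) y ->
    exists2 w, ideal_mul (ideal_exp A (a N.+1))
                 (ideal_mul I (ideal_exp (ideal_adjoin I x) N)) w &
      c * x ^+ N.+1 * y = c * w.
Proof.
have [R0|R1] := eqVneq (1 : R) 0.
  have all0 (u v : R) : u = v by rewrite -[u]mul1r -[v]mul1r R0 !mul0r.
  move=> _ _ _ _; exists 0%N => y _; exists 0; last exact: all0.
  by apply: ideal0; apply: ideal_mul_ideal.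
have [R' RE] := comPzRing_nontrivial R1.
case: R / RE I A c x {R1} => I A c x; exact: stable_reduction_nz.
Qed.

Section IntegralityCriteria.
Variable R : comPzRingType.
Hypothesis R_noeth : noetherian R.
Implicit Types (I A : set R) (x y z c : R).

(** The classical criterion [c x^n] in [I^n], deduced from [stable_reduction]
    with [A = R]. *)
Lemma integral_of_exp I c x n0 :
  is_ideal I -> avoids_minimal_primes c ->
  (forall n, (n0 <= n)%N -> ideal_exp I n (c * x ^+ n)) ->
  integral_closure I x.
Proof.
move=> idI hc cx; have idT := @setT_ideal R.
have [n y n0n _|N] := stable_reduction (c := c) (x := x) (a := fun=> 0%N)
  (n0 := n0) R_noeth idI idT.
  by rewrite mulrC; apply: ideal_mulP => //; apply: cx.
case/(_ 1)=> // w; rewrite ideal_mulT; last exact: ideal_mul_ideal.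
set J := ideal_adjoin I x => Iw; rewrite mulr1 => e.
have [|M uM] := avoids_annihilator_nilpotent R_noeth hc (x := x ^+ N.+1 - w).
  by rewrite mulrBr e subrr.
have Ju : ideal_exp J N.+1 (x ^+ N.+1 - w).
  have idJ := ideal_exp_ideal J N.+1.
  apply: (idealD idJ); first by apply: ideal_expX; apply: mem_ideal_adjoin.
  apply: (idealN idJ); apply: ideal_mulS Iw => //; exact: sub_ideal_adjoin.
(* Elements [x^p - w] with [p > 0] and [w] in [I J^(p-1)] are stable under
   products. *)
have [q [w' Iw' e']] : exists q, exists2 w', ideal_mul I (ideal_exp J q) w' &
    (x ^+ N.+1 - w) ^+ M.+1 = x ^+ q.+1 - w'.
  elim: M {uM} => [|M [q [w' Iw' e']]]; first by exists N, w.
  exists (N.+1 + q)%N, (w * x ^+ q.+1 + (x ^+ N.+1 - w) * w').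
    apply: (idealD (ideal_mul_ideal _ _)).
    - rewrite mulrC; apply: ideal_mul_mulr Iw => u Ju'.
      rewrite addSnnS addnC; apply: ideal_expM => //.
      by apply: ideal_expX; apply: mem_ideal_adjoin.
    - by apply: ideal_mul_mulr Iw' => u; apply: ideal_expM.
  by rewrite exprS e' mulrBr mulrBl -exprD addnS opprD addrA.
apply: (@reduction_integral _ _ _ q); move: e'.
by rewrite exprS uM mulr0 => /esym/subr0_eq ->.
Qed.

(** With [J = I + (x)] and [M = c A^q J^N], the relation of [stable_reduction]
    becomes [x M <= I M] (this is [step], where [V k] is [A^q I^k J^N]).  Hence
    any [d] in [M] and [R°] satisfies [d x^n] in [I^n] for all [n]. *)
Lemma integral_of_mul_exp I A c x (a : nat -> nat) n0 :
  is_ideal I -> positive_height I -> is_ideal A -> positive_height A ->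
  avoids_minimal_primes c ->
  (forall n y, (n0 <= n)%N -> ideal_exp A (a n) y ->
    ideal_mul (ideal_exp A (a n)) (ideal_exp I n) (c * x ^+ n * y)) ->
  integral_closure I x.
Proof.
move=> idI htI idA htA hc /(stable_reduction R_noeth idI idA)[N NP].
set J := ideal_adjoin I x in NP; set q := a N.+1 in NP.
pose V k := ideal_mul (ideal_exp A q) (ideal_mul (ideal_exp I k) (ideal_exp J N)).
have idV k : is_ideal (V k) by apply: ideal_mul_ideal.
have step k : V k `<=` [set v | exists2 w, V k.+1 w & c * x * v = c * w].
  have idS := ideal_preimM (c * x) c (idV k.+1).
  apply: (ideal_mul_sub idS) => y u Ay Iu.
  apply: (ideal_mul_sub (ideal_colon y idS) _ Iu) => b j Ib Jj /=.
  have Jxj : ideal_exp J N.+1 (x * j).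
    by apply: ideal_mulP => //; apply: mem_ideal_adjoin.
  have [r [w' Iw' e']] := ideal_adjoin_exp Jxj.
  have [w Aw e] := NP _ Ay.
  have bV v : ideal_mul I (ideal_exp J N) v ->
      ideal_mul (ideal_exp I k.+1) (ideal_exp J N) (b * v).
    by apply: ideal_mul_mull => i Ii; rewrite mulrC; apply: ideal_mulP.
  exists (r * (b * w) + y * (b * w')).
    apply: (idealD (idV _)); first by apply: (idealMl _ (idV _)); apply: ideal_mul_mulr Aw.
    by apply: ideal_mulP => //; apply: bV.
  have -> : c * x * (y * (b * j)) = c * (y * b * (x * j)) by ring.
  have -> : c * (r * (b * w) + y * (b * w')) = r * b * (c * w) + c * (y * b * w') by ring.
  by rewrite e' -e; ring.
have [f If hf] := positive_height_avoids R_noeth idI htI.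
have [g Ag hg] := positive_height_avoids R_noeth idA htA.
apply: (@integral_of_exp _ (c * (g ^+ q * f ^+ N)) _ 0%N idI).
  by do 2?[apply: avoidsM => //]; apply: avoidsX.
move=> n _; suff [w Vw ->] : exists2 w, V n w & c * (g ^+ q * f ^+ N) * x ^+ n = c * w.
  apply: (idealMl _ (ideal_exp_ideal I n)).
  apply: ideal_mul_sub Vw => [|y u _]; first exact: ideal_exp_ideal.
  move=> Iu; apply: (idealMl _ (ideal_exp_ideal I n)); move: Iu.
  apply: ideal_mul_sub => [|b j Ib _]; first exact: ideal_exp_ideal.
  exact: idealMr (ideal_exp_ideal I n) Ib.
elim: n => [|n [w /step[w' Vw' e'] e]].
  exists (g ^+ q * f ^+ N); last by rewrite mulr1.
  apply: ideal_mulP; first exact: ideal_expX.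
  rewrite -[f ^+ N]mul1r; apply: ideal_mulP => //; apply: ideal_expX.
  exact: sub_ideal_adjoin.
by exists w' => //; rewrite exprSr mulrA e mulrAC e'.
Qed.

End IntegralityCriteria.

(** * The two closures *)

Lemma ceil_mulE (K : realType) (t : K) n :
  0 <= t -> (ceil_mul t n)%:Z = Num.ceil (t * n%:R).
Proof.
move=> t0; rewrite /ceil_mul gez0_abs // ceil_ge0.
by apply: lt_le_trans (mulr_ge0 t0 (ler0n _ _)); lra.
Qed.

Lemma ceil_mul_leq (K : realType) (t s : K) n :
  0 <= t -> t <= s -> (ceil_mul t n <= ceil_mul s n)%N.
Proof.
move=> t0 ts; rewrite -lez_nat !ceil_mulE ?(le_trans t0)//.
by apply: le_ceil; apply: ler_wpM2r.
Qed.

(** Both ceilings exceed their argument by less than 1, so the excess of the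
    sum is an integer smaller than 2. *)
Lemma ceil_mulD (K : realType) (t : K) m n :
  0 <= t -> (ceil_mul t m + ceil_mul t n <= (ceil_mul t (m + n)).+1)%N.
Proof.
move=> t0; rewrite -lez_nat -[in X in _ <= X]addn1 !PoszD !ceil_mulE //.
rewrite -ltzD1 -(ltr_int K) !rmorphD /=.
have := ceilB1_lt (t * m%:R); have := ceilB1_lt (t * n%:R).
have := ceil_ge (t * (m + n)%:R); rewrite !rmorphB natrD mulrDr /=; lra.
Qed.

Section Closures.
Variables (R : comPzRingType) (K : realType).
Implicit Types (I J A B : set R) (t s : K).

(** Multiplying [c] by the [n0]-th power of an element of [I] in [R°] takes care
    of the exponents below [n0]. *)
Lemma hara_yoshida_all_exponents A t I x :
  is_ideal I -> noetherian R -> positive_height I ->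
  hara_yoshida_closure A t I x <->
  exists2 c, avoids_minimal_primes c &
    forall n y, ideal_exp A (ceil_mul t n) y -> ideal_exp I n (c * x ^+ n * y).
Proof.
move=> idI R_noeth htI; split=> [[c hc [n0 _ cx]]|[c hc cx]]; last first.
  by exists c => //; exists 0%N => // n _ _ [y Ay <-]; apply: cx.
have [f If hf] := positive_height_avoids R_noeth idI htI.
exists (f ^+ n0 * c) => [|n y Ay]; first by apply: avoidsM => //; apply: avoidsX.
have [n0n|nn0] := leqP n0 n.
  rewrite -!mulrA; apply: (idealMl _ (ideal_exp_ideal I n)); rewrite mulrA.
  by apply: cx n0n _ _; exists y.
rewrite -!mulrA; apply: (idealMr _ (ideal_exp_ideal I n)).
by apply: ideal_exp_leq (ltnW nn0) _ _; apply: ideal_expX.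
Qed.

Lemma ideal_expD A m n :
  ideal_exp A (m + n) `<=` ideal_mul (ideal_exp A m) (ideal_exp A n).
Proof.
elim: m => [|m IH]; first by rewrite ideal_mulT //; apply: ideal_exp_ideal.
apply: ideal_mul_sub => [|a y Aa /IH Ay]; first exact: ideal_mul_ideal.
by apply: ideal_mul_mull Ay => z Az; apply: ideal_mulP.
Qed.

(** For a sum, every term of the binomial expansion of [(x + y)^n] is treated
    with the multiplier [c d g]: the element [g] of [A] turns [A^(a n)] into
    [A^(a n + 1)], which lies in [A^(a (n-i)) A^(a i)]. *)
Lemma hara_yoshida_ideal A t I : noetherian R ->
  is_ideal I -> positive_height I -> is_ideal A -> positive_height A ->
  0 <= t -> is_ideal (hara_yoshida_closure A t I).
Proof.
move=> R_noeth idI htI idA htA t0; have idIn := ideal_exp_ideal I.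
split=> [|x y|r x].
- exists 1; first exact: avoids1.
  exists 1%N => // -[//|n] _ _ [y _ <-].
  by rewrite exprS mul0r mulr0 mul0r; apply: (ideal0 (idIn _)).
- move=> /(hara_yoshida_all_exponents A t _ idI R_noeth htI)[c hc cx].
  move=> /(hara_yoshida_all_exponents A t _ idI R_noeth htI)[d hd dy].
  have [g Ag hg] := positive_height_avoids R_noeth idA htA.
  apply/(hara_yoshida_all_exponents A t _ idI R_noeth htI).
  exists (c * d * g) => [|n z Az]; first by do 2?[apply: avoidsM => //].
  rewrite exprDn -mulrA mulr_suml mulr_sumr; apply: (ideal_sum _ (idIn n)) => i _.
  rewrite mulrnAl mulrnAr -mulr_natl; apply: (idealMl _ (idIn n)).
  have ni : (n - i + i = n)%N by rewrite subnK // -ltnS.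
  have: ideal_mul (ideal_exp A (ceil_mul t (n - i))) (ideal_exp A (ceil_mul t i)) (g * z).
    apply: ideal_expD; apply: (ideal_exp_leq (n := (ceil_mul t n).+1)).
      by have := ceil_mulD (n - i) i t0; rewrite ni.
    exact: ideal_mulP.
  have -> : c * d * g * (x ^+ (n - i) * y ^+ i * z) =
            c * d * x ^+ (n - i) * y ^+ i * (g * z) by ring.
  apply: (ideal_mul_sub (ideal_colon _ (idIn n))) => u v Au Av /=.
  have -> : c * d * x ^+ (n - i) * y ^+ i * (u * v) =
            c * x ^+ (n - i) * u * (d * y ^+ i * v) by ring.
  by have := ideal_expM (cx _ _ Au) (dy _ _ Av); rewrite ni.
- case=> c hc [n0 _ cx]; exists c => //; exists n0 => // n n0n _ [y Ay <-].
  have -> : c * (r * x) ^+ n * y = r ^+ n * (c * x ^+ n * y) by rewrite exprMn; ring.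
  by apply: (idealMl _ (idIn n)); apply: cx n0n _ _; exists y.
Qed.

Lemma vraciu_sub_hara_yoshida A t I :
  vraciu_closure A t I `<=` hara_yoshida_closure A t I.
Proof.
move=> x [c hc [n0 _ cx]]; exists c => //; exists n0 => // n n0n z /(cx n n0n).
by apply: ideal_mul_subr; apply: ideal_exp_ideal.
Qed.

Lemma hara_yoshidaS A B t s I J :
  0 <= t -> t <= s -> B `<=` A -> I `<=` J ->
  hara_yoshida_closure A t I `<=` hara_yoshida_closure B s J.
Proof.
move=> t0 ts BA IJ x [c hc [n0 _ cx]]; exists c => //; exists n0 => // n n0n _ [y By <-].
apply: (ideal_expS IJ); apply: cx n0n _ _; exists y => //.
exact/(ideal_expS BA)/(ideal_exp_leq (ceil_mul_leq _ t0 ts)).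
Qed.

Lemma integral_closure_vraciu A t I : noetherian R ->
  is_ideal I -> positive_height I -> is_ideal A -> positive_height A ->
  integral_closure I = vraciu_closure A t I.
Proof.
move=> R_noeth idI htI idA htA; apply/seteqP; split=> x.
  move=> /integral_exp[k xk].
  have [f If hf] := positive_height_avoids R_noeth idI htI.
  exists (f ^+ k); first exact: avoidsX.
  exists 0%N => // n _ _ [y Ay <-]; rewrite mulrC; apply: ideal_mulP => //.
  apply: (@ideal_exp_leq _ _ _ (k + (n - k))); first by lia.
  by apply: ideal_expM => //; apply: ideal_expX.
move=> [c hc [n0 _ cx]].
apply: (integral_of_mul_exp (c := c) (a := ceil_mul t) (n0 := n0)
  R_noeth idI htI idA htA) => //.
by move=> n y n0n Ay; apply: cx n0n _ _; exists y.
Qed.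

Lemma vraciu_setT t I : is_ideal I ->
  vraciu_closure setT t I = hara_yoshida_closure setT t I.
Proof.
move=> idI; apply/seteqP; split; first exact: vraciu_sub_hara_yoshida.
move=> x [c hc [n0 _ cx]]; exists c => //; exists n0 => // n n0n z /(cx n n0n).
by rewrite ideal_expT ideal_mulT //; apply: ideal_exp_ideal.
Qed.

End Closures.

Theorem proposition3p3 (R : comPzRingType) (K : realType) (I A : set R) (t : K)
    (R_noeth : noetherian R)
    (I_ideal : is_ideal I) (I_ht : positive_height I)
    (A_ideal : is_ideal A) (A_ht : positive_height A)
    (t_gt0 : 0 < t) :
  [/\ (* (a) *)
      is_ideal (vraciu_closure A t I) /\ is_ideal (hara_yoshida_closure A t I),
      (* (b) *)
      integral_closure I = vraciu_closure A t I /\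
      vraciu_closure A t I `<=` hara_yoshida_closure A t I
    & (* (c) *)
      forall (J B : set R) (s : K),
        is_ideal J -> is_ideal B -> 0 < s ->
        I `<=` J -> B `<=` A -> t <= s ->
        hara_yoshida_closure A t I `<=` hara_yoshida_closure B s J].
Proof.
have t_ge0 := ltW t_gt0.
have T_ideal := @setT_ideal R; have T_ht := @setT_positive_height R.
split; first split.
(* The Vraciu closure is the same for [A] and for the unit ideal. *)
- rewrite -integral_closure_vraciu // (@integral_closure_vraciu _ _ setT t) //.
  by rewrite vraciu_setT //; apply: hara_yoshida_ideal.
- exact: hara_yoshida_ideal.
- by split; [apply: integral_closure_vraciu|apply: vraciu_sub_hara_yoshida].
- by move=> J B s _ _ _ IJ BA ts; apply: hara_yoshidaS.
Qed.
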